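(* Let $n\ge 1$ and let $P\in\operatorname{Sym}_{2n+1}$. Then there exists a unique $Q\in\operatorname{Sym}_n$ such that \[ P\left(x_1,\ldots,x_n,x_1^{-1},\ldots,x_n^{-1},1\right)=Q\left(x_1+x_1^{-1},\ldots,x_n+x_n^{-1}\right). \]
   Context: $\operatorname{Sym}_N$ denotes the algebra of symmetric polynomials in $N$ variables with complex coefficients. The displayed identity is an identity of Laurent polynomials in the independent variables $x_1,\ldots,x_n$. *)

(* Defs.v *)
From mathcomp Require Import all_boot all_algebra.
From mathcomp Require Import reals.
From mathcomp Require Import complex.
From mathcomp Require Import mpoly.

Set Implicit Arguments.
Unset Strict Implicit.
Unset Printing Implicit Defensive.

Import GRing.Theory.

Local Open Scope ring_scope.

(* The ring of Laurent polynomials in x_0, ..., x_(n-1) over C is the subring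
   of the field of rational functions generated over C by the x_i and their
   inverses; identities between Laurent polynomials are stated in this field. *)
Definition ratfun (C : fieldType) (n : nat) : fieldType :=
  {fraction {mpoly C[n]}}.

Definition ratvar (C : fieldType) (n : nat) (i : 'I_n) : ratfun C n :=
  tofrac 'X_i.

Definition ratsubst (C : fieldType) (n N : nat) (v : 'I_N -> ratfun C n)
    (p : {mpoly C[N]}) : ratfun C n :=
  mmap (@tofrac {mpoly C[n]} \o @mpolyC n C) v p.

Definition inv_seq (C : fieldType) (n : nat) : seq (ratfun C n) :=
  [seq ratvar C i | i <- enum 'I_n]
    ++ [seq (ratvar C i)^-1 | i <- enum 'I_n] ++ [:: 1].

Fact size_inv_seq (C : fieldType) (n : nat) :
  size (inv_seq C n) = (2 * n + 1)%N.
Proof.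
have szE (T : Type) (f : 'I_n -> T) : size [seq f i | i <- enum 'I_n] = n.
  by rewrite size_map size_enum_ord.
by rewrite /inv_seq !size_cat !szE addnA addnn mul2n.
Qed.

Definition inv_point (C : fieldType) (n : nat) :
    'I_(2 * n + 1) -> ratfun C n :=
  tnth (Tuple (introT eqP (size_inv_seq C n))).

Definition sum_point (C : fieldType) (n : nat) : 'I_n -> ratfun C n :=
  fun i => ratvar C i + (ratvar C i)^-1.

(* Main.v *)
Require Import Defs.
From HB Require Import structures.
From mathcomp Require Import all_boot all_algebra.
From mathcomp Require Import order fingroup perm.
From mathcomp Require Import reals.
From mathcomp Require Import complex.
From mathcomp Require Import mpoly.
From mathcomp Require Import ring.

(** Write y_i = x_i + x_i^-1 and let v be the point
    (x_1, ..., x_n, x_1^-1, ..., x_n^-1, 1), so that the theorem compares P(v)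
    with Q(y).

    Existence.  The monic polynomial in t whose roots are the entries of v is
      (t - 1) \prod_i (t - x_i) (t - x_i^-1)
        = (t - 1) \prod_i (t^2 - y_i t + 1),
    because x_i and x_i^-1 have product 1.  The right-hand side is the value at
    y of a polynomial whose coefficients are symmetric in n variables
    ([sum_charpoly]), so by Viete each elementary symmetric polynomial, taken
    at v, is a symmetric polynomial in y ([mesym_inv_point]).  By the
    fundamental theorem P is a polynomial in the elementary symmetric ones,
    hence P(v) is a symmetric polynomial in y ([ratsubst_inv_point_sym]).

    Uniqueness.  The y_i are algebraically independent
    ([ratsubst_sum_point_inj]).  For d large, (x_1 ... x_n)^d y^m is the
    polynomial \prod_i x_i^(d - m_i) (x_i^2 + 1)^(m_i), whose leading monomial
    is x^((d, ..., d) + m) ([mlead_cleared]).  Distinct m give distinct leading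
    monomials, so no cancellation can make a nontrivial linear combination of
    the y^m vanish. *)

Import Order.TTheory GRing.Theory.

Local Open Scope ring_scope.

(** * Substitution homomorphisms *)

HB.instance Definition _ (C : fieldType) (n N : nat) (v : 'I_N -> ratfun C n) :=
  GRing.RMorphism.copy (@ratsubst C n N v)
    (mmap (@tofrac {mpoly C[n]} \o @mpolyC n C) v).

Lemma ratsubstXU (C : fieldType) (n N : nat) (v : 'I_N -> ratfun C n) i :
  ratsubst v 'X_i = v i.
Proof. by rewrite /ratsubst mmapX mmap1U. Qed.

Lemma ratsubst_comp (C : fieldType) (n N M : nat) (v : 'I_N -> ratfun C n)
    (q : M.-tuple {mpoly C[N]}) (p : {mpoly C[M]}) :
  ratsubst v (p \mPo q) = ratsubst (fun i => ratsubst v (tnth q i)) p.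
Proof.
rewrite comp_mpolyEX raddf_sum /=; apply: eq_bigr => m _.
rewrite [LHS]mmapZ; congr (_ * _).
rewrite comp_mpolyX -/(ratsubst v _) rmorph_prod.
by apply: eq_bigr => i _; rewrite rmorphXn.
Qed.

Lemma ratsubst_mesym (C : fieldType) (n N : nat) (v : 'I_N -> ratfun C n) k :
  ratsubst v (mesym N C k) = (mesym N (ratfun C n) k).@[v].
Proof.
rewrite /mesym raddf_sum [RHS]raddf_sum; apply: eq_bigr => h _ /=.
rewrite rmorph_prod [RHS]rmorph_prod.
by apply: eq_bigr => i _; rewrite /= ratsubstXU mevalXU.
Qed.

Lemma comp_mpoly_sym (C : fieldType) (n M : nat) (q : M.-tuple {mpoly C[n]})
    (p : {mpoly C[M]}) :
  (forall i, tnth q i \is symmetric) -> p \mPo q \is symmetric.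
Proof.
move=> sym_q; rewrite comp_mpolyEX; apply: rpred_sum => m _; apply: rpredZ.
by rewrite comp_mpolyX; apply: rpred_prod => i _; apply: rpredX.
Qed.

Lemma mpvar_neq0 (C : fieldType) (n : nat) (i : 'I_n) :
  'X_i != 0 :> {mpoly C[n]}.
Proof. by rewrite -mleadc_eq0 mleadXm mcoeffX eqxx oner_eq0. Qed.

Lemma ratvar_neq0 (C : fieldType) (n : nat) (i : 'I_n) : ratvar C i != 0.
Proof. by rewrite /ratvar tofrac_eq0 mpvar_neq0. Qed.

(** * The polynomial whose roots are x_i, x_i^-1 and 1 *)

(** Here 'X_i stands for x_i + x_i^-1, the trace of the reciprocal pair whose
    quadratic is the i-th factor; the linear factor accounts for the entry 1. *)
Definition sum_charpoly (C : fieldType) (n : nat) : {poly {mpoly C[n]}} :=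
  ('X - 1) * \prod_(i < n) ('X^2 - ('X_i)%:P * 'X + 1).

Lemma quadratic_factor (A : comPzRingType) (x a b : A) :
  x ^+ 2 - (a + b) * x + a * b = (x - a) * (x - b).
Proof. by ring. Qed.

(** Pairing x_i with its inverse turns the 2n + 1 linear factors into the n
    quadratics and the one linear factor of [sum_charpoly]. *)
Lemma map_sum_charpoly (C : fieldType) (n : nat) :
  map_poly (ratsubst (@sum_point C n)) (sum_charpoly C n)
  = \prod_(c <- inv_seq C n) ('X - c%:P).
Proof.
have prod_enum (F : 'I_n -> ratfun C n) :
    \prod_(c <- [seq F i | i <- enum 'I_n]) ('X - c%:P)
    = \prod_(i < n) ('X - (F i)%:P).
  by rewrite big_map big_enum.
rewrite /inv_seq 2!big_cat big_seq1 /= 2!prod_enum mulrA -big_split /=.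
rewrite mulrC rmorphM rmorphB rmorph1 rmorph_prod /= map_polyX; congr (_ * _).
apply: eq_bigr => i _.
rewrite rmorphD rmorphB rmorph1 /= map_polyXn rmorphM /= map_polyX.
rewrite map_polyC /= ratsubstXU /sum_point polyCD.
(* Make the constant term of the quadratic visible as a product of roots. *)
have <-: (ratvar C i)%:P * ((ratvar C i)^-1)%:P = 1 :> {poly ratfun C n}.
  by rewrite -polyCM divff ?ratvar_neq0.
exact: quadratic_factor.
Qed.

Lemma msymXU (C : fieldType) (n : nat) (s : {perm 'I_n}) (i : 'I_n) :
  msym s 'X_i = 'X_(s i) :> {mpoly C[n]}.
Proof.
rewrite msymX; congr mpolyX; apply/mnmP=> j; rewrite mnmE !mnm1E.
by rewrite -(inj_eq (@perm_inj _ s)) permKV.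
Qed.

(** A permutation of the variables only permutes the quadratic factors. *)
Lemma sum_charpoly_sym (C : fieldType) (n k : nat) :
  (sum_charpoly C n)`_k \is symmetric.
Proof.
apply/issymP => s; rewrite -coef_map; congr ((polyseq _)`_k).
rewrite /sum_charpoly rmorphM rmorphB rmorph1 rmorph_prod /= map_polyX.
congr (_ * _); rewrite [RHS](reindex_inj (@perm_inj _ s)); apply: eq_bigr => i _.
rewrite rmorphD rmorphB rmorph1 /= map_polyXn rmorphM /= map_polyX.
by rewrite map_polyC /= msymXU.
Qed.

(** Viete's formula, read off from the factorization of the image of
    [sum_charpoly]. *)
Lemma mesym_inv_point (C : fieldType) (n k : nat) : (k <= 2 * n + 1)%N ->
  ratsubst (@inv_point C n) (mesym (2 * n + 1) C k)
  = ratsubst (@sum_point C n) ((-1) ^+ k * (sum_charpoly C n)`_(2 * n + 1 - k)).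
Proof.
move=> le_k; rewrite ratsubst_mesym.
rewrite rmorphM rmorph_sign -coef_map map_sum_charpoly.
pose v := Tuple (introT eqP (size_inv_seq C n)).
have lt_k : (k < (2 * n + 1).+1)%N by [].
by rewrite (mroots_coeff v (Ordinal lt_k)) signrMK.
Qed.

(** * Existence *)

Lemma ratsubst_inv_point_sym (C : fieldType) (n : nat)
    (P : {mpoly C[2 * n + 1]}) : P \is symmetric ->
  exists2 Q : {mpoly C[n]}, Q \is symmetric &
    ratsubst (@inv_point C n) P = ratsubst (@sum_point C n) Q.
Proof.
move=> /sym_fundamental [t [<- _]].
pose c := [tuple (-1) ^+ k.+1 * (sum_charpoly C n)`_(2 * n + 1 - k.+1)
          | k < 2 * n + 1].
exists (t \mPo c).
  apply: comp_mpoly_sym => k; rewrite tnth_mktuple.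
  by rewrite rpredMsign sum_charpoly_sym.
rewrite !ratsubst_comp; apply: eq_bigr => m _; congr (_ * _).
by apply: mmap1_eq => k; rewrite !tnth_mktuple mesym_inv_point.
Qed.

(** * Algebraic independence of the x_i + x_i^-1 *)

(** The monomial of exponent m in the x_i + x_i^-1, with its denominators
    cleared by the d-th power of x_1 ... x_n; see [clearedE]. *)
Definition cleared (C : fieldType) (n d : nat) (m : 'X_{1..n}) : {mpoly C[n]} :=
  \prod_(i < n) ('X_i ^+ (d - m i) * ('X_i ^+ 2 + 1) ^+ m i).

Lemma clearedE (C : fieldType) (n d : nat) (m : 'X_{1..n}) :
  (forall i, (m i <= d)%N) ->
  tofrac (cleared C n d m)
  = (\prod_(i < n) ratvar C i) ^+ d * mmap1 (@sum_point C n) m.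
Proof.
move=> le_md; rewrite rmorph_prod -prodrXl -big_split; apply: eq_bigr => i _ /=.
rewrite rmorphM !rmorphXn rmorphD rmorph1 rmorphXn -/(ratvar C i) /sum_point.
rewrite -{2}(subnK (le_md i)) exprD -mulrA -exprMn mulrDr -expr2.
by rewrite divff ?ratvar_neq0.
Qed.

Lemma mlead_mpvar_sqrD1 (C : fieldType) (n : nat) (i : 'I_n) :
  mlead ('X_i ^+ 2 + 1 : {mpoly C[n]}) = (U_(i) *+ 2)%MM.
Proof.
rewrite mpolyXn mleadDl mleadXm // mlead1.
by apply: lt_mdeg_ltmc; rewrite mdeg0 mdegMn mdeg1.
Qed.

Lemma mpvar_sqrD1_neq0 (C : fieldType) (n : nat) (i : 'I_n) :
  'X_i ^+ 2 + 1 != 0 :> {mpoly C[n]}.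
Proof.
apply/eqP => X2_0; have := mlead_mpvar_sqrD1 C n i.
by rewrite X2_0 mlead0 => /(congr1 (@mdeg n)); rewrite mdeg0 mdegMn mdeg1.
Qed.

Lemma cleared_factor_neq0 (C : fieldType) (n a b : nat) (i : 'I_n) :
  'X_i ^+ a * ('X_i ^+ 2 + 1) ^+ b != 0 :> {mpoly C[n]}.
Proof. by rewrite mulf_neq0 ?expf_neq0 ?mpvar_sqrD1_neq0 ?mpvar_neq0. Qed.

Lemma mlead_cleared_factor (C : fieldType) (n a b : nat) (i : 'I_n) (j : 'I_n) :
  mlead ('X_i ^+ a * ('X_i ^+ 2 + 1) ^+ b : {mpoly C[n]}) j
  = ((i == j) * (a + 2 * b))%N.
Proof.
rewrite mleadM ?expf_neq0 ?mpvar_sqrD1_neq0 ?mpvar_neq0 //.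
rewrite !mleadX ?mpvar_sqrD1_neq0 ?mpvar_neq0 // mlead_mpvar_sqrD1 mleadXm.
by rewrite mnmDE !mulmnE mnm1E -mulnA -mulnDr.
Qed.

Lemma cleared_neq0 (C : fieldType) (n d : nat) (m : 'X_{1..n}) :
  cleared C n d m != 0.
Proof. by apply/prodf_neq0 => i _; apply: cleared_factor_neq0. Qed.

(** The i-th factor has leading exponent (d - m_i) + 2 m_i = d + m_i, so the
    leading monomial recovers m. *)
Lemma mlead_cleared (C : fieldType) (n d : nat) (m : 'X_{1..n}) :
  (forall i, (m i <= d)%N) ->
  mlead (cleared C n d m) = ([multinom d | i < n] + m)%MM.
Proof.
move=> le_md; rewrite mlead_prod => [|i _ _]; last exact: cleared_factor_neq0.
apply/mnmP => j; rewrite mnm_sumE mnmDE mnmE (bigD1 j) //= big1 => [|i ne_ij].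
  by rewrite mlead_cleared_factor eqxx mul1n addn0 mul2n -addnn addnA subnK.
by rewrite mlead_cleared_factor (negbTE ne_ij).
Qed.

(** If the image of p vanishes, then so does the combination of the cleared
    monomials with the coefficients of p.  Its coefficient at (d, ..., d) plus
    the leading exponent of p receives a contribution from the leading term of
    p alone, since all other leading exponents are smaller. *)
Lemma ratsubst_sum_point_inj (C : fieldType) (n : nat) :
  injective (ratsubst (@sum_point C n)).
Proof.
apply: raddf_inj => p p0; apply/eqP; apply: contraT => nz_p.
(* The size exceeds the total degree, hence bounds every exponent in p. *)
pose d := msize p.
have le_d m : m \in msupp p -> forall i, (m i <= d)%N.
  move=> /msize_mdeg_lt /ltnW le_m i; apply: leq_trans le_m.
  by rewrite mdegE (bigD1 i) //= leq_addr.
have: \sum_(m <- msupp p) p@_m *: cleared C n d m = 0.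
  apply/eqP; rewrite -tofrac_eq0 raddf_sum /=; apply/eqP.
  transitivity ((\prod_(i < n) ratvar C i) ^+ d * ratsubst (@sum_point C n) p).
    rewrite /ratsubst /mmap mulr_sumr big_seq [RHS]big_seq.
    apply: eq_bigr => m /le_d le_m.
    by rewrite -mul_mpolyC rmorphM /= clearedE //= mulrCA.
  by rewrite p0 mulr0.
move/(congr1 (mcoeff ([multinom d | i < n] + mlead p))).
rewrite raddf_sum mcoeff0 (bigD1_seq (mlead p)) ?mlead_supp ?msupp_uniq //=.
rewrite big_seq_cond big1 ?addr0 => [|m /andP[m_p ne_m]]; last first.
  rewrite mcoeffZ [X in _ * X]mcoeff_gt_mlead ?mulr0 //.
  rewrite mlead_cleared; last exact: le_d.
  by rewrite ltmc_add2r lt_neqAle ne_m msupp_le_mlead.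
rewrite mcoeffZ -(mlead_cleared C); last exact/le_d/mlead_supp.
move/eqP; rewrite mulf_eq0 !mleadc_eq0 (negbTE nz_p).
by rewrite (negbTE (cleared_neq0 _ _ _ _)).
Qed.

Theorem theorem1p2 (R : realType) (n : nat) (hn : (1 <= n)%N)
    (P : {mpoly R[i][2 * n + 1]}) (hP : P \is symmetric) :
  exists! Q : {mpoly R[i][n]},
    Q \is symmetric /\
    ratsubst (@inv_point R[i] n) P = ratsubst (@sum_point R[i] n) Q.
Proof.
have [Q symQ defQ] := ratsubst_inv_point_sym _ _ P hP.
exists Q; split=> // Q' [_ defQ']; apply: ratsubst_sum_point_inj.
by rewrite -defQ -defQ'.
Qed.
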